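(* Let $\psi$ be a real-valued function defined on all positive integers such that $\psi(n) \to \infty$ as $n \to \infty$. Then $B(n) \leq n^{\tau(n)\psi(n)}$ for almost all $n$, i.e., for all positive integers $n$ except for a set with asymptotic density $0$.
   Context: The height $H(f)$ of a polynomial $f$ with integer coefficients is the largest absolute value of a coefficient of $f$. For a positive integer $n$, $B(n) = \max\{H(f) : f(x) \in \mathbb{Z}[x],\ f(x) \mid x^n - 1 \text{ in } \mathbb{Z}[x]\}$, and $\tau(n)$ denotes the number of positive divisors of $n$. *)

(* Defs.v *)
From HB Require Import structures.
From mathcomp Require Import all_boot all_order all_algebra all_field.
From mathcomp Require Import all_classical all_reals all_analysis.
Set Implicit Arguments. Unset Strict Implicit. Unset Printing Implicit Defensive.
Import Order.TTheory GRing.Theory Num.Theory.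
Import numFieldNormedType.Exports.
Local Open Scope classical_set_scope.
Local Open Scope ring_scope.

Definition height (f : {poly int}) : nat := (\max_(i < size f) `|(f`_i)%R|)%N.

(* Divisibility in Z[x] itself: [%|] on [{poly int}] is pseudo-divisibility,
   i.e. divisibility over the fraction field. *)
Definition zpoly_dvd (f g : {poly int}) : Prop := exists h, g = h * f.

Definition is_max_height (n m : nat) : Prop :=
  (exists2 f : {poly int}, zpoly_dvd f ('X^n - 1) & height f = m) /\
  (forall f : {poly int}, zpoly_dvd f ('X^n - 1) -> (height f <= m)%N).

(* The maximum exists for every [0 < n], see [is_max_height_B] below;
   [B 0] is the default value [0]. *)
Definition B (n : nat) : nat := xget 0%N [set m | is_max_height n m].

Definition tau (n : nat) : nat := size (divisors n).

Definition has_asymptotic_density (R : realType) (A : set nat) (d : R) : Prop :=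
  (count (fun n => n \in A) (iota 1 N))%:R / N%:R @[N --> \oo] --> d.

Definition for_almost_all (R : realType) (P : nat -> Prop) : Prop :=
  has_asymptotic_density [set n | (0 < n)%N /\ ~ P n] (0 : R).

Lemma is_max_height_uniq n m1 m2 :
  is_max_height n m1 -> is_max_height n m2 -> m1 = m2.
Proof.
move=> [[f1 d1 <-] M1] [[f2 d2 <-] M2].
by apply/eqP; rewrite eqn_leq M1 // M2.
Qed.

Lemma coef_prod_XsubC_le (s : seq algC) i :
  (forall z, z \in s -> `|z| = 1) ->
  `|(\prod_(z <- s) ('X - z%:P))`_i| <= (2 ^ size s)%:R.
Proof.
elim: s i => [|z s IHs] i hs.
  by rewrite big_nil coef1; case: (i == 0%N); rewrite ?normr1 ?normr0.
have hs' y : y \in s -> `|y| = 1 by move=> ys; rewrite hs // inE ys orbT.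
rewrite big_cons mulrBl coefB coefXM coefCM.
apply: le_trans (ler_normB _ _) _.
rewrite normrM (hs z) ?mem_head // mul1r /= expnS mul2n -addnn natrD.
apply: lerD; last exact: IHs.
by case: (i == 0%N); [rewrite normr0 ler0n | exact: IHs].
Qed.

Lemma height_dvd_le n (f : {poly int}) :
  (0 < n)%N -> zpoly_dvd f ('X^n - 1) -> (height f <= 2 ^ n)%N.
Proof.
move=> n_gt0 [h fh].
have lc1 : `|lead_coef f|%N = 1%N.
  have := congr1 lead_coef fh; rewrite lead_coefM lead_coefXnsubC // => e.
  have := congr1 absz e; rewrite abszM /= => /esym/eqP.
  by rewrite muln_eq1 => /andP[_ /eqP].
have [z zn] := C_prim_root_exists n_gt0.
pose F := map_poly (intr : int -> algC) f.
have lcF : `|lead_coef F| = 1.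
  rewrite lead_coef_map_inj ?rmorph0 //; last exact: intr_inj.
  by rewrite -intr_norm -natr_absz lc1.
have : F %| \prod_(x <- [seq z ^+ k | k <- iota 0 n]) ('X - x%:P).
  rewrite big_map; have := factor_Xn_sub_1 zn; rewrite /index_iota subn0 => ->.
  have -> : 'X^n - 1 = map_poly (intr : int -> algC) ('X^n - 1).
    by rewrite rmorphB rmorph1 /= map_polyXn.
  by rewrite fh rmorphM dvdp_mull.
move=> /dvdp_prod_XsubC[m].
set s := mask m _ => FE.
have sn : (size s <= n)%N.
  by rewrite (leq_trans (size_subseq (mask_subseq _ _))) // size_map size_iota.
have s1 x : x \in s -> `|x| = 1.
  move=> /mem_mask /mapP[k _ ->]; rewrite normrX.
  have /eqP -> : `|z| == 1.
    by rewrite -(pexpr_eq1 n_gt0) // -normrX (prim_expr_order zn) normr1.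
  by rewrite expr1n.
apply/bigmax_leqP => i _.
have Fi : F`_i = lead_coef F * (\prod_(x <- s) ('X - x%:P))`_i.
  rewrite {1}(eqpfP FE) (monicP (monic_prod_XsubC _ _ _)) invr1 mulr1.
  by rewrite coefZ.
have FiE : (f`_i)%:~R = F`_i :> algC by rewrite coef_map.
rewrite -(ler_nat algC) natr_absz intr_norm FiE Fi normrM lcF mul1r.
rewrite (le_trans (coef_prod_XsubC_le _ s1)) //.
by rewrite ler_nat leq_exp2l.
Qed.

Lemma is_max_height_B n : (0 < n)%N -> is_max_height n (B n).
Proof.
move=> n_gt0; apply: xgetPex.
pose Q m := `[< exists2 f : {poly int}, zpoly_dvd f ('X^n - 1) & height f = m >].
have exQ : exists m, Q m.
  exists (height ('X^n - 1)); apply/asboolP.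
  by exists ('X^n - 1) => //; exists 1; rewrite mul1r.
have ubQ m : Q m -> (m <= 2 ^ n)%N.
  by move=> /asboolP[f fd <-]; exact: height_dvd_le.
have [m /asboolP Qm maxm] := ex_maxnP exQ ubQ.
by exists m; split=> // f fd; apply: maxm; apply/asboolP; exists f.
Qed.

(* Main.v *)
Require Import Defs.
From mathcomp Require Import all_boot all_order all_algebra all_field.
From mathcomp Require Import all_classical all_reals all_analysis.
From mathcomp Require Import ring lra zify.
Set Implicit Arguments. Unset Strict Implicit. Unset Printing Implicit Defensive.
Import Order.TTheory GRing.Theory Num.Theory.
Import numFieldNormedType.Exports.
Local Open Scope classical_set_scope.
Local Open Scope ring_scope.

(** Write [L] for the sum of the absolute values of the coefficients, which is
    submultiplicative and bounds the height.  Since the cyclotomic polynomials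
    are prime in Z[x], a divisor of [X^n - 1] is, up to sign, a product of
    distinct ['Phi_d] with [d %| n]; so [B n] is at most the product of the
    [L 'Phi_d] over the [tau n] divisors of [n].

    To bound [L 'Phi_d], let [Psi m = (X^m - 1) / 'Phi_m] and
    [c m = L 'Phi_m * L (Psi m)] ([PhiPsi_norm]).  If [p] is a prime that does
    not divide [m], the identities
      ['Phi_(m p) = 'Phi_m(X^p) * Psi m / (X^m - 1)] and
      [Psi (m p) = 'Phi_m * Psi m (X^p)]
    give [c (m p) <= p * c m ^ 2], while [c (m p) <= c m] if [p %| m].  Adding
    the primes of [n] in increasing order, [ln (c n)] is therefore bounded by
    the sum over [p %| n] of [2^j * ln p], up to a constant factor, where [j]
    counts the larger primes that divide [n].  For a typical [n] the logarithms
    of its primes, listed downwards, decay like [e^-j], and [2 < e] makes the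
    sum [O(ln n)].

    The first moment of this sum is too large by an iterated logarithm, so it
    is its square root that is averaged.  Since the square root is subadditive,
    that root is bounded by a quantity [load N n], where adding [p] multiplies
    by [sqrt 2] and adds [sqrt (ln p)].  Its mean over [n <= N] is at most
    [mean_load N], which obeys
      [T_p = T_(p-1) * (1 + (sqrt 2 - 1) / p) + sqrt (ln p) / p].
    With [s_N] the sum of [ln p / p] over [p <= N], one has
    [sqrt s_p - sqrt s_(p-1) >= ln p / (2 p * sqrt s_p)], and an upper bound
    [s_N <= 1.15 * ln N] for large [N] is enough for [T_N <= C * sqrt s_N] to
    propagate, because [1.15 * (sqrt 2 - 1) < 1 / 2].  That bound on [s_N] comes
    from summing [ln k], over [k <= 16 N], against the prime divisors of [k].

    So [load N n] has mean [O(sqrt (ln N))] ([mean_load_le]).  Markov's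
    inequality then shows that [load N n ^ 2 <= psi n * ln n] for almost all [n],
    which is the claim, as [B n <= expR (tau n * load N n ^ 2)]
    ([B_le_expR]). *)

(** * The coefficient norm of integer polynomials *)

Definition l1norm (f : {poly int}) : nat := (\sum_(i < size f) `|(f`_i)%R|)%N.

Lemma l1norm_wide n (f : {poly int}) :
  (size f <= n)%N -> l1norm f = (\sum_(i < n) `|(f`_i)%R|)%N.
Proof.
move=> fn; rewrite /l1norm (big_ord_widen n (fun i => `|(f`_i)%R|%N)) //.
rewrite big_mkcond /=; apply: eq_bigr => i _; case: ltnP => // fi.
by rewrite nth_default.
Qed.

Lemma height_le_l1norm f : (height f <= l1norm f)%N.
Proof. by apply/bigmax_leqP => i _; rewrite /l1norm (bigD1 i) //= leq_addr. Qed.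

Lemma l1normD f g : (l1norm (f + g) <= l1norm f + l1norm g)%N.
Proof.
set n := maxn (size f) (size g).
rewrite (@l1norm_wide n f) ?leq_maxl // (@l1norm_wide n g) ?leq_maxr //.
rewrite (l1norm_wide (size_polyD f g)) -/n -big_split /=.
by apply: leq_sum => i _; rewrite coefD -lez_nat PoszD !abszE ler_normD.
Qed.

Lemma l1norm0 : l1norm 0 = 0%N.
Proof. by rewrite /l1norm size_poly0 big_ord0. Qed.

Lemma l1norm1 : l1norm 1 = 1%N.
Proof. by rewrite /l1norm size_poly1 big_ord1 coef1. Qed.

Lemma l1norm_gt0 f : f != 0 -> (0 < l1norm f)%N.
Proof.
move=> f0; have lt : ((size f).-1 < size f)%N by rewrite ltn_predL size_poly_gt0.
rewrite /l1norm (bigD1 (Ordinal lt)) //= addn_gt0 absz_gt0.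
by rewrite -lead_coefE lead_coef_eq0 f0.
Qed.

Lemma l1norm_sum (I : Type) (r : seq I) (F : I -> {poly int}) :
  (l1norm (\sum_(i <- r) F i) <= \sum_(i <- r) l1norm (F i))%N.
Proof.
elim: r => [|i r IH]; first by rewrite !big_nil l1norm0.
by rewrite !big_cons (leq_trans (l1normD _ _)) // leq_add2l.
Qed.

Lemma l1norm_monomial_mul c k g :
  (l1norm (c *: ('X^k * g)) <= `|c| * l1norm g)%N.
Proof.
rewrite (@l1norm_wide (k + size g)); last first.
  rewrite (leq_trans (size_scale_leq _ _)) // (leq_trans (size_polyMleq _ _)) //.
  by rewrite size_polyXn.
rewrite big_split_ord /= big1 ?add0n => [|i _]; last first.
  by rewrite coefZ coefXnM ltn_ord mulr0.
rewrite big_distrr /=; apply: leq_sum => i _.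
by rewrite coefZ coefXnM ltnNge leq_addr /= addKn abszM.
Qed.

Lemma l1normM f g : (l1norm (f * g) <= l1norm f * l1norm g)%N.
Proof.
rewrite -{1}[f]coefK poly_def mulr_suml.
rewrite (leq_trans (l1norm_sum _ _)) // /(l1norm f) big_distrl /=.
by apply: leq_sum => i _; rewrite -scalerAl l1norm_monomial_mul.
Qed.

Lemma l1norm_Xn k : (l1norm 'X^k <= 1)%N.
Proof.
have := l1norm_monomial_mul 1 k 1.
by rewrite scale1r mulr1 l1norm1.
Qed.

Lemma l1norm_comp_Xn f k : (l1norm (f \Po 'X^k) <= l1norm f)%N.
Proof.
rewrite comp_polyE (leq_trans (l1norm_sum _ _)) //.
apply: leq_sum => i _; rewrite -exprM -[X in _ *: X]mulr1.
by rewrite (leq_trans (l1norm_monomial_mul _ _ _)) // l1norm1 muln1.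
Qed.

Lemma l1norm_take n f : (l1norm (take_poly n f) <= l1norm f)%N.
Proof.
rewrite (@l1norm_wide (size f)); last first.
  apply/leq_sizeP => i fi; rewrite coef_take_poly; case: ifP => // _.
  by rewrite nth_default.
by apply: leq_sum => i _; rewrite coef_take_poly; case: ifP.
Qed.

Lemma l1normN f : l1norm (- f) = l1norm f.
Proof.
rewrite /l1norm size_polyN; apply: eq_bigr => i _; by rewrite coefN abszN.
Qed.

Lemma l1norm_XnsubC1 n : (l1norm ('X^n - 1) <= 2)%N.
Proof.
by rewrite (leq_trans (l1normD _ _)) // l1normN l1norm1 addn1 ltnS l1norm_Xn.
Qed.

(** Multiplying [G * (X^m - 1) = A] by [1 + X^m + ... + X^(m(p-1))] turns the
    left side into [G * X^(m p) - G], whose low part is [- G] because [G] has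
    degree less than [m p]; the multiplier has norm at most [p]. *)
Lemma l1norm_div_Xnsub1 (G A : {poly int}) m p : (0 < m)%N ->
  (size G <= m * p)%N -> G * ('X^m - 1) = A -> (l1norm G <= p * l1norm A)%N.
Proof.
move=> m0 sG GA.
pose Q : {poly int} := \sum_(i < p) ('X^m) ^+ i.
have E : - (A * Q) = G + (- G) * 'X^(m * p).
  rewrite -GA -mulrA -subrX1 -exprM; ring.
rewrite -(take_polyDMXn (- G) sG) -E.
rewrite (leq_trans (l1norm_take _ _)) // l1normN.
rewrite (leq_trans (l1normM _ _)) // mulnC leq_mul2r; apply/orP; right.
rewrite (leq_trans (l1norm_sum _ _)) //.
apply: (@leq_trans (\sum_(i < p) 1)); last by rewrite sum1_card card_ord.
by apply: leq_sum => i _; rewrite -exprM l1norm_Xn.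
Qed.

(** * Cyclotomic polynomials and the divisors of X^n - 1 *)

Lemma Cyclotomic_neq0 n : 'Phi_n != 0.
Proof. exact: monic_neq0 (Cyclotomic_monic n). Qed.

(** A primitive root of order [n] is a root of one of the factors, and ['Phi_n]
    is its minimal polynomial; being monic, ['Phi_n] divides in Z[x] whatever
    it divides over the rationals. *)
Lemma Cyclotomic_dvdM n (f g h : {poly int}) : (0 < n)%N ->
  f * g = 'Phi_n * h ->
  (exists k, f = 'Phi_n * k) \/ (exists k, g = 'Phi_n * k).
Proof.
move=> n0 fg; have [z zn] := C_prim_root_exists n0.
have key (u : {poly int}) : root (map_poly (intr : int -> algC) u) z ->
    exists k, u = 'Phi_n * k.
  move=> uz.
  have dv : 'Phi_n %| u.
    have [q [Dq mq] minq] := minCpolyP z.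
    have Eint (v : {poly int}) : map_poly (intr : int -> algC) v =
        map_poly ratr (map_poly (intr : int -> rat) v).
      by rewrite -map_poly_comp; apply: eq_map_poly => b; rewrite /= rmorph_int.
    rewrite -dvdp_rat_int.
    have -> : map_poly intr 'Phi_n = q.
      apply: (map_inj_poly (f := (ratr : rat -> algC))).
      - exact: fmorph_inj.
      - by rewrite raddf0.
      by rewrite -Eint (Cintr_Cyclotomic zn) -(minCpoly_cyclotomic zn).
    by rewrite -minq -Eint.
  have [k] := dvdpP_int dv.
  by rewrite zprimitive_monic ?Cyclotomic_monic // => ->; exists k.
have : root (map_poly (intr : int -> algC) (f * g)) z.
  by rewrite fg rmorphM rootM /= (Cintr_Cyclotomic zn) root_cyclotomic ?zn.
by rewrite rmorphM rootM /= => /orP[] /key; [left|right].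
Qed.

(** Each ['Phi_d] can be cancelled from one of the two cofactors.  Those that
    go to [f] contribute their norm, and the others a factor at least [1]. *)
Lemma l1norm_dvd_prod_Cyclotomic (s : seq nat) (f h : {poly int}) :
  (forall d, d \in s -> 0 < d)%N -> h * f = \prod_(d <- s) 'Phi_d ->
  (l1norm f <= \prod_(d <- s) l1norm 'Phi_d)%N.
Proof.
elim: s f h => [|d s IH] f h s0.
  rewrite !big_nil => hf.
  have := congr1 lead_coef hf; rewrite lead_coefM lead_coef1 => /eqP.
  have s1 : size (h * f) = 1%N by rewrite hf size_poly1.
  have [h0 f0] : h != 0 /\ f != 0.
    by apply/andP; rewrite -negb_or -mulf_eq0 hf oner_eq0.
  have sf : size f = 1%N.
    move: s1 h0 f0; rewrite -!size_poly_gt0 => s1 h0 f0; move: s1.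
    rewrite size_mul -?size_poly_gt0 //.
    by case: (size h) h0 => // a _; case: (size f) f0 => // b _; lia.
  rewrite /l1norm sf big_ord1 => /eqP/(congr1 absz)/eqP; rewrite abszM.
  by rewrite muln_eq1 /lead_coef sf => /andP[_ /eqP ->].
rewrite !big_cons => hf.
have d0 : (0 < d)%N by apply: s0; rewrite mem_head.
have s0' e : e \in s -> (0 < e)%N by move=> es; apply: s0; rewrite inE es orbT.
have [[k Ek]|[k Ek]] := Cyclotomic_dvdM d0 hf.
  have := IH f k s0'; rewrite Ek -mulrA in hf.
  move/(mulfI (Cyclotomic_neq0 d)): hf => hf /(_ hf) h1.
  by rewrite (leq_trans h1) // leq_pmull // l1norm_gt0 // Cyclotomic_neq0.
rewrite Ek mulrCA in hf.
move/(mulfI (Cyclotomic_neq0 d)): hf => hf.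
by rewrite Ek (leq_trans (l1normM _ _)) // leq_mul2l (IH k h s0' hf) orbT.
Qed.

(** The inverse cyclotomic polynomial [(X^m - 1) / 'Phi_m]. *)
Definition Psi m : {poly int} := \prod_(d <- rem m (divisors m)) 'Phi_d.

Lemma Psi_neq0 n : Psi n != 0.
Proof. by apply/monic_neq0/monic_prod => d _; exact: Cyclotomic_monic. Qed.

Lemma Cyclotomic_mul_Psi m : (0 < m)%N -> 'Phi_m * Psi m = 'X^m - 1.
Proof.
move=> m0; rewrite -prod_Cyclotomic // (big_rem m) //.
exact: divisors_id.
Qed.

(** Multiplicative Moebius inversion, in the form of uniqueness. *)
Lemma prod_divisors_inj (R : idomainType) (F G : nat -> R) :
  (forall m, (0 < m)%N -> G m != 0) ->
  (forall m, (0 < m)%N ->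
     \prod_(d <- divisors m) F d = \prod_(d <- divisors m) G d) ->
  forall m, (0 < m)%N -> F m = G m.
Proof.
move=> G0 FG; elim/ltn_ind => m IH m0.
have := FG m m0; rewrite !(big_rem m (divisors_id m0)) /=.
have -> : \prod_(d <- rem m (divisors m)) F d =
          \prod_(d <- rem m (divisors m)) G d.
  apply: eq_big_seq => d; rewrite mem_rem_uniq ?divisors_uniq // inE.
  rewrite -dvdn_divisors //.
  move=> /andP[dm dvm]; apply: IH; last exact: dvdn_gt0 dvm.
  by rewrite ltn_neqAle dm dvdn_leq.
apply: mulIf; rewrite prodf_seq_neq0; apply/allP => d /mem_rem.
by rewrite -dvdn_divisors // => /(dvdn_gt0 m0)/G0.
Qed.

(** Both sides have the product [X^(k p) - 1] over the divisors of any [k]: the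
    divisors of [k * p] are the [d * p] with [d %| k] together with the divisors
    of [k] that are prime to [p]. *)
Lemma Cyclotomic_comp_Xn p m : prime p -> (0 < m)%N ->
  'Phi_m \Po 'X^p = 'Phi_(m * p) * (if (p %| m)%N then 1 else 'Phi_m).
Proof.
move=> pp; have p0 := prime_gt0 pp.
pose F m := 'Phi_m \Po 'X^p.
pose G m := 'Phi_(m * p) * (if (p %| m)%N then 1 else 'Phi_m).
apply: (@prod_divisors_inj _ F G) => k k0.
  rewrite mulf_neq0 ?Cyclotomic_neq0 //.
  by case: ifP; rewrite ?oner_eq0 ?Cyclotomic_neq0.
have -> : \prod_(d <- divisors k) F d = 'X^(k * p) - 1.
  transitivity ((\prod_(d <- divisors k) 'Phi_d) \Po 'X^p : {poly int}).
    by rewrite rmorph_prod.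
  by rewrite prod_Cyclotomic // comp_polyB comp_Xn_poly -exprM mulnC comp_polyC.
have kp0 : (0 < k * p)%N by rewrite muln_gt0 k0.
rewrite -prod_Cyclotomic // /G big_split /=.
rewrite (bigID (fun d => p %| d)%N) /=; congr (_ * _).
  rewrite -(big_map (fun d => d * p)%N predT (fun d => 'Phi_d)) -big_filter.
  apply: perm_big; apply: uniq_perm.
  - by rewrite filter_uniq // divisors_uniq.
  - rewrite map_inj_uniq ?divisors_uniq // => a b /eqP.
    by rewrite eqn_pmul2r // => /eqP.
  move=> d; rewrite mem_filter -dvdn_divisors //; apply/idP/mapP.
    move=> /andP[/dvdnP[e ->]]; rewrite dvdn_pmul2r // => ek.
    by exists e => //; rewrite -dvdn_divisors.
  by case=> e; rewrite -dvdn_divisors // => ek ->; rewrite dvdn_mull // dvdn_pmul2r.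
have -> : \prod_(d <- divisors k) (if (p %| d)%N then 1 else 'Phi_d) =
          \prod_(d <- divisors k | ~~ (p %| d)%N) 'Phi_d.
  by rewrite [RHS]big_mkcond; apply: eq_bigr => d _; case: ifP.
rewrite -big_filter -[RHS]big_filter; apply: perm_big; apply: uniq_perm.
- by rewrite filter_uniq // divisors_uniq.
- by rewrite filter_uniq // divisors_uniq.
move=> d; rewrite !mem_filter -!dvdn_divisors //.
have [//|pd] := boolP (p %| d)%N; rewrite /= Gauss_dvdl //.
by rewrite coprime_sym prime_coprime.
Qed.

(** The two norms are bounded together because the recursion for each of them,
    on adding a prime, involves both. *)
Definition PhiPsi_norm n := (l1norm 'Phi_n * l1norm (Psi n))%N.

Lemma l1norm_Cyclotomic_le n : (l1norm 'Phi_n <= PhiPsi_norm n)%N.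
Proof. by rewrite leq_pmulr // l1norm_gt0 // Psi_neq0. Qed.

Lemma PhiPsi_norm_gt0 n : (0 < PhiPsi_norm n)%N.
Proof. by rewrite muln_gt0 !l1norm_gt0 ?Psi_neq0 ?Cyclotomic_neq0. Qed.

Lemma PhiPsi_norm1 : (PhiPsi_norm 1 <= 2)%N.
Proof.
have := Cyclotomic_mul_Psi (ltn0Sn 0); rewrite /PhiPsi_norm /Psi big_nil mulr1 => ->.
by rewrite l1norm1 muln1 l1norm_XnsubC1.
Qed.

Lemma totient_ltn n : (1 < n)%N -> (totient n < n)%N.
Proof.
move=> n1; rewrite totient_count_coprime big_ltn ?(ltnW n1) //.
have -> : coprime n 0 = false by rewrite /coprime gcdn0; apply: gtn_eqF.
rewrite add0n (@leq_ltn_trans (\sum_(1 <= d < n) 1)%N) //.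
  by apply: leq_sum => d _; case: (coprime _ _).
by rewrite sum_nat_const_nat muln1; lia.
Qed.

Lemma XnsubC1_comp_Xn (m p : nat) :
  ('X^m - 1 : {poly int}) \Po 'X^p = 'X^(m * p) - 1.
Proof. by rewrite comp_polyB comp_Xn_poly -exprM mulnC comp_polyC. Qed.

Lemma PhiPsi_norm_mul_dvd p m : prime p -> (0 < m)%N -> (p %| m)%N ->
  (PhiPsi_norm (m * p) <= PhiPsi_norm m)%N.
Proof.
move=> pp m0 pm; have := Cyclotomic_comp_Xn pp m0; rewrite pm mulr1 => E.
have mp0 : (0 < m * p)%N by rewrite muln_gt0 m0 prime_gt0.
have EP : Psi (m * p) = Psi m \Po 'X^p.
  apply: (mulfI (Cyclotomic_neq0 (m * p))).
  rewrite Cyclotomic_mul_Psi // -E -comp_polyM Cyclotomic_mul_Psi //.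
  by rewrite XnsubC1_comp_Xn.
by rewrite /PhiPsi_norm -E EP leq_mul // l1norm_comp_Xn.
Qed.

(** The exponent [2] is the source of the weights [2^j], and the factor [p] is
    the price of the division by [X^m - 1]. *)
Lemma PhiPsi_norm_mul_coprime p m : prime p -> (0 < m)%N -> ~~ (p %| m)%N ->
  (PhiPsi_norm (m * p) <= p * PhiPsi_norm m ^ 2)%N.
Proof.
move=> pp m0 pm; have := Cyclotomic_comp_Xn pp m0; rewrite (negbTE pm) => E.
have mp0 : (0 < m * p)%N by rewrite muln_gt0 m0 prime_gt0.
have EP : Psi (m * p) = 'Phi_m * (Psi m \Po 'X^p).
  apply: (mulfI (Cyclotomic_neq0 (m * p))).
  rewrite Cyclotomic_mul_Psi // mulrA -E -comp_polyM Cyclotomic_mul_Psi //.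
  by rewrite XnsubC1_comp_Xn.
have EG : 'Phi_(m * p) * ('X^m - 1) = ('Phi_m \Po 'X^p) * Psi m.
  by rewrite E -mulrA Cyclotomic_mul_Psi.
have sG : (size 'Phi_(m * p) <= m * p)%N.
  rewrite size_Cyclotomic; apply: totient_ltn.
  by rewrite (leq_trans (prime_gt1 pp)) // leq_pmull.
rewrite {1}/PhiPsi_norm EP.
apply: (@leq_trans ((p * (l1norm 'Phi_m * l1norm (Psi m))) *
                     (l1norm 'Phi_m * l1norm (Psi m)))%N).
  apply: leq_mul.
    rewrite (leq_trans (l1norm_div_Xnsub1 m0 sG EG)) // leq_mul2l.
    apply/orP; right; rewrite (leq_trans (l1normM _ _)) //.
    by rewrite leq_mul2r l1norm_comp_Xn orbT.
  by rewrite (leq_trans (l1normM _ _)) // leq_mul2l l1norm_comp_Xn orbT.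
by rewrite -mulnA mulnn.
Qed.

Lemma PhiPsi_norm_mul_pfactor q m k : prime q -> (0 < m)%N ->
  (PhiPsi_norm (m * q ^ k.+1) <= PhiPsi_norm (m * q))%N.
Proof.
move=> qp m0; elim: k => [|k IH] //.
rewrite expnSr mulnA (leq_trans _ IH) // PhiPsi_norm_mul_dvd //.
  by rewrite muln_gt0 m0 expn_gt0 prime_gt0.
by rewrite expnSr mulnA dvdn_mull.
Qed.

(** * A recursive bound for the norms of cyclotomic polynomials *)

Section Load.
Variable R : realType.
Implicit Types (N n m : nat).

(** Unfolded, this is a sum over the primes [p <= N] dividing [n] of
    [sqrt (2^j * ln p)], with [j] the number of primes in [(p, N]] dividing [n],
    plus a term that comes from the norm [2] of ['Phi_1].  The recursion on [N]
    visits the primes in increasing order, so that the largest ones, whose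
    logarithms dominate, get the smallest weights. *)
Fixpoint load N n : R :=
  if N is N'.+1 then
    if prime N && (N %| n)%N
    then Num.sqrt 2 * load N' n + Num.sqrt (ln N%:R)
    else load N' n
  else Num.sqrt (ln 2).

Lemma load_ge0 N n : 0 <= load N n.
Proof.
elim: N => [|N IH] /=; first exact: sqrtr_ge0.
by case: ifP => // _; rewrite addr_ge0 ?sqrtr_ge0 ?mulr_ge0 ?sqrtr_ge0.
Qed.

Lemma sqrt2_ge1 : 1 <= Num.sqrt 2 :> R.
Proof. by rewrite -[leLHS]sqrtr1 ler_wsqrtr // ler1n. Qed.

Lemma load_leS N n : load N n <= load N.+1 n.
Proof.
rewrite /=; case: ifP => // _.
rewrite -[leLHS]addr0 lerD ?sqrtr_ge0 // ler_peMl ?load_ge0 ?sqrt2_ge1 //.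
Qed.

(** This replaces the loads of all the divisors of [n] by the load of [n]. *)
Lemma load_dvd N n m : (n %| m)%N -> load N n <= load N m.
Proof.
move=> nm; elim: N => [|N IH] //=.
case: ifP => [/andP[-> /= /dvdn_trans -> //]|_].
  by rewrite lerD2r ler_wpM2l ?sqrtr_ge0.
exact: (le_trans IH (load_leS N m)).
Qed.

Lemma sqrt_add_le (x y : R) : 0 <= x -> 0 <= y ->
  Num.sqrt (x + y) <= Num.sqrt x + Num.sqrt y.
Proof.
move=> x0 y0; rewrite -(@ler_pXn2r _ 2) ?nnegrE ?addr_ge0 ?sqrtr_ge0 //.
rewrite sqrrD !sqr_sqrtr ?addr_ge0 // lerD2r lerDl.
by rewrite mulrn_wge0 // mulr_ge0 ?sqrtr_ge0.
Qed.

Lemma ler_sqrt_ln (x y : R) :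
  0 < x -> x <= y -> Num.sqrt (ln x) <= Num.sqrt (ln y).
Proof.
by move=> x0 xy; rewrite ler_wsqrtr // ler_ln ?posrE // (lt_le_trans x0).
Qed.

(** Induction on the bound for the primes of [n]: strip the whole power of the
    largest prime [q] from [n], and use that the square root is subadditive to
    pass from [PhiPsi_norm n <= q * PhiPsi_norm m ^ 2] to the recursion of
    [load]. *)
Lemma sqrt_ln_PhiPsi_norm_le N n : (0 < n)%N ->
  (forall p, prime p -> (p %| n)%N -> (p <= N)%N) ->
  Num.sqrt (ln (PhiPsi_norm n)%:R) <= load N n.
Proof.
elim: N n => [|N IH] n n0 Pn.
  have -> : n = 1%N.
    apply/eqP; rewrite eqn_leq n0 andbT leqNgt; apply/negP => n1.
    have := Pn _ (pdiv_prime n1) (pdiv_dvd n).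
    by rewrite leqn0 => /eqP E; have := pdiv_prime n1; rewrite E.
  by rewrite /= ler_sqrt_ln ?ltr0n ?PhiPsi_norm_gt0 // ler_nat PhiPsi_norm1.
have [/andP[qp qn]|nq] := boolP (prime N.+1 && (N.+1 %| n)%N); last first.
  rewrite /= (negbTE nq); apply: IH => // p pp pn.
  have := Pn p pp pn; rewrite leq_eqVlt => /orP[/eqP E|//].
  by rewrite -E pp pn in nq.
set q := N.+1 in qp qn *.
have [m qm nE] := pfactor_coprime qp n0.
have m0 : (0 < m)%N by move: n0; rewrite nE muln_gt0 => /andP[].
have qndvd : ~~ (q %| m)%N by rewrite -prime_coprime.
have IHm : Num.sqrt (ln (PhiPsi_norm m)%:R) <= load N m.
  apply: IH => // p pp pm.
  have pn : (p %| n)%N by rewrite nE dvdn_mulr.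
  have := Pn p pp pn; rewrite leq_eqVlt => /orP[/eqP E|//].
  by move: qndvd; rewrite -[q]E pm.
have cle : (PhiPsi_norm n <= q * PhiPsi_norm m ^ 2)%N.
  rewrite (leq_trans _ (PhiPsi_norm_mul_coprime qp m0 qndvd)) //.
  have : (0 < logn q n)%N by rewrite logn_gt0 mem_primes qp n0 qn.
  by rewrite {2}nE; case: (logn q n) => // k _; apply: PhiPsi_norm_mul_pfactor.
have -> : load N.+1 n = Num.sqrt 2 * load N n + Num.sqrt (ln q%:R).
  by rewrite /= qp qn.
apply: (@le_trans _ _ (Num.sqrt (ln (q * PhiPsi_norm m ^ 2)%:R))).
  by rewrite ler_sqrt_ln ?ltr0n ?PhiPsi_norm_gt0 // ler_nat.
have c1 : 1 <= (PhiPsi_norm m)%:R :> R by rewrite ler1n PhiPsi_norm_gt0.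
have q1 : 1 <= q%:R :> R by rewrite ler1n prime_gt0.
have c0 := lt_le_trans ltr01 c1; have q0 := lt_le_trans ltr01 q1.
rewrite natrM natrX lnM ?posrE ?exprn_gt0 // lnXn // addrC.
apply: (le_trans (sqrt_add_le _ _)); rewrite ?mulrn_wge0 ?ln_ge0 //.
rewrite lerD2r -[ln _ *+ 2]mulr_natl sqrtrM ?ler0n // ler_wpM2l ?sqrtr_ge0 //.
apply: (le_trans IHm); apply: load_dvd; by rewrite nE dvdn_mulr.
Qed.

(** Each of the [tau n] divisors of [n] contributes a cyclotomic factor of norm
    at most [expR (load N n ^ 2)]. *)
Lemma B_le_expR N n : (0 < n <= N)%N ->
  (B n)%:R <= expR ((tau n)%:R * load N n ^+ 2) :> R.
Proof.
move=> /andP[n0 nN]; have [[f [h hf] <-] _] := is_max_height_B n0.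
apply: (@le_trans _ _ (\prod_(d <- divisors n) l1norm 'Phi_d)%N%:R).
  rewrite ler_nat (leq_trans (height_le_l1norm f)) //.
  apply: (@l1norm_dvd_prod_Cyclotomic _ f h).
    by move=> d; rewrite -dvdn_divisors // => /(dvdn_gt0 n0).
  by rewrite prod_Cyclotomic.
rewrite natr_prod /tau -sum1_size natr_sum mulr_suml.
rewrite expR_sum [leLHS]big_seq [leRHS]big_seq.
apply: ler_prod => d; rewrite -dvdn_divisors // => dn; rewrite ler0n /= mul1r.
have d0 := dvdn_gt0 n0 dn.
have c0 : 0 < (PhiPsi_norm d)%:R :> R by rewrite ltr0n PhiPsi_norm_gt0.
apply: (@le_trans _ _ (PhiPsi_norm d)%:R); first by rewrite ler_nat l1norm_Cyclotomic_le.
rewrite -[leLHS]lnK ?posrE // ler_expR.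
rewrite -[leLHS]sqr_sqrtr ?ln_ge0 ?ler1n ?PhiPsi_norm_gt0 //.
rewrite ler_pXn2r ?nnegrE ?sqrtr_ge0 ?load_ge0 //.
apply: le_trans (load_dvd N dn).
apply: sqrt_ln_PhiPsi_norm_le => // p pp pd.
by rewrite (leq_trans (dvdn_leq d0 pd)) // (leq_trans (dvdn_leq n0 dn)).
Qed.

End Load.

(** * The mean of the bound *)

Lemma count_dvdn_iota d N :
  count (fun n => d %| n)%N (index_iota 1 N.+1) = (N %/ d)%N.
Proof.
rewrite divn_count_dvd -sum1_count big_mkcond /=.
by apply: eq_bigr => i _; case: (d %| i)%N.
Qed.

Section Mean.
Variable R : realType.
Implicit Types (N n m : nat).

(** Averaging the recursion of [load], a prime acts with probability [1 / p]. *)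
Fixpoint mean_load N : R :=
  if N is N'.+1 then
    if prime N
    then mean_load N' * (1 + (Num.sqrt 2 - 1) / N%:R)
         + Num.sqrt (ln N%:R) / N%:R
    else mean_load N'
  else Num.sqrt (ln 2).

(** The restriction to multiples of [m] is what makes the induction on [K] work:
    the prime [K + 1] modifies the load exactly on the multiples of [m * (K + 1)],
    where the induction hypothesis applies again. *)
Lemma sum_load_le K N m : (0 < m)%N ->
  (forall p, prime p -> (p <= K)%N -> ~~ (p %| m)%N) ->
  \sum_(1 <= n < N.+1 | (m %| n)%N) load R K n <= N%:R / m%:R * mean_load K.
Proof.
elim: K m => [|K IH] m m0 mP.
  rewrite /= big_const_seq count_dvdn_iota iter_addr_0 -[_ *+ _]mulr_natl.
  rewrite ler_wpM2r ?sqrtr_ge0 //.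
  by rewrite ler_pdivlMr ?ltr0n // -natrM ler_nat leq_trunc_div.
have mP' p : prime p -> (p <= K)%N -> ~~ (p %| m)%N.
  by move=> pp pK; apply: mP => //; exact: leqW.
have IHm := IH m m0 mP'.
case: (boolP (prime K.+1)) => qp; last first.
  by rewrite /= (negbTE qp).
set q := K.+1 in qp *.
have q0 : 0 < q%:R :> R by rewrite ltr0n.
have m0' : 0 < m%:R :> R by rewrite ltr0n.
have cqm : coprime m q by rewrite coprime_sym prime_coprime // mP.
have mq0 : (0 < m * q)%N by rewrite muln_gt0 m0.
have IHq := IH (m * q)%N mq0.
have {}IHq : \sum_(1 <= n < N.+1 | (m * q %| n)%N) load R K n
    <= N%:R / (m * q)%:R * mean_load K.
  apply: IHq => p pp pK; rewrite Euclid_dvdM // negb_or mP' //=.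
  by rewrite dvdn_prime2 // neq_ltn ltnS pK.
have cnt : \sum_(1 <= n < N.+1 | (m * q %| n)%N) 1 <= N%:R / (m * q)%:R :> R.
  rewrite big_const_seq count_dvdn_iota iter_addr_0.
  by rewrite ler_pdivlMr ?ltr0n // -natrM ler_nat leq_trunc_div.
have s1 := sqrt2_ge1 R.
have -> : \sum_(1 <= n < N.+1 | (m %| n)%N) load R q n =
  \sum_(1 <= n < N.+1 | (m %| n)%N) load R K n +
  \sum_(1 <= n < N.+1 | (m * q %| n)%N)
     ((Num.sqrt 2 - 1) * load R K n + Num.sqrt (ln q%:R)).
  rewrite !(big_mkcond (fun n => _ %| n)%N) -big_split /=.
  apply: eq_bigr => n _; rewrite (Gauss_dvd _ cqm) qp /=.
  case: (boolP (m %| n)%N) => _ /=; last by rewrite addr0.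
  by case: ifP => _; rewrite ?addr0 //; ring.
rewrite big_split /= -mulr_sumr.
have -> : \sum_(1 <= n < N.+1 | (m * q %| n)%N) Num.sqrt (ln q%:R) =
   Num.sqrt (ln q%:R) * \sum_(1 <= n < N.+1 | (m * q %| n)%N) 1 :> R.
  by rewrite mulr_sumr; apply: eq_bigr => n _; rewrite mulr1.
rewrite qp.
have -> : N%:R / m%:R * (mean_load K * (1 + (Num.sqrt 2 - 1) / q%:R) +
     Num.sqrt (ln q%:R) / q%:R) = N%:R / m%:R * mean_load K +
   ((Num.sqrt 2 - 1) * (N%:R / (m * q)%:R * mean_load K) +
    Num.sqrt (ln q%:R) * (N%:R / (m * q)%:R)).
  by rewrite natrM; field; rewrite ?lt0r_neq0.
rewrite lerD // lerD // ler_wpM2l ?sqrtr_ge0 // subr_ge0 //.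
Qed.

End Mean.

(** * Sums over primes *)

Lemma prod_primes_dvdn m k : (0 < k)%N ->
  (\prod_(1 <= p < m.+1 | prime p && (p %| k)) p %| k)%N.
Proof.
move=> k0; elim: m => [|m IH]; first by rewrite big_geq.
rewrite big_mkcond big_nat_recr //= -big_mkcond /=.
case: ifP => [/andP[pp pk]|_]; last by rewrite muln1.
rewrite Gauss_dvd ?IH ?pk // coprime_sym prime_coprime //.
rewrite big_seq_cond Euclid_dvd_prod // big_has_cond.
apply/hasPn => i; rewrite mem_index_iota => /andP[i0 im].
apply/negP => /= /andP[/and3P[_ ip _]].
by rewrite dvdn_prime2 // => /eqP E; move: im; rewrite -E ltnn.
Qed.

Section PrimeSums.
Variable R : realType.
Implicit Types (N n m : nat).

Definition sum_ln_prime_div N : R := \sum_(1 <= p < N.+1 | prime p) ln p%:R / p%:R.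

Lemma sum_ln_prime_divS N : sum_ln_prime_div N.+1 =
  sum_ln_prime_div N + (if prime N.+1 then ln N.+1%:R / N.+1%:R else 0).
Proof.
by rewrite /sum_ln_prime_div big_mkcond big_nat_recr //= -big_mkcond.
Qed.

(** The product of the primes dividing [k] divides [k]. *)
Lemma sum_ln_primes_dvd_le m k : (0 < k)%N ->
  \sum_(1 <= p < m.+1 | prime p && (p %| k)%N) ln p%:R <= ln k%:R :> R.
Proof.
move=> k0; have P := prod_primes_dvdn m k0.
apply: (@le_trans _ _ (ln (\prod_(1 <= p < m.+1 | prime p && (p %| k)) p)%N%:R)).
  rewrite le_eqVlt; apply/orP; left; apply/eqP.
  suff: forall s : seq nat, \sum_(p <- s | prime p && (p %| k)%N) ln p%:R =
    ln (\prod_(p <- s | prime p && (p %| k)) p)%N%:R :> R by apply.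
  elim=> [|p s IH]; first by rewrite !big_nil ln1.
  rewrite !big_cons; case: ifP => // /andP[pp _].
  have prod_gt0 : (0 < \prod_(j <- s | prime j && (j %| k)) j)%N.
    elim/big_ind: _ => [|x y x0 y0|i /andP[/prime_gt0 //]] //.
    by rewrite muln_gt0 x0.
  by rewrite natrM lnM ?posrE ?ltr0n ?(prime_gt0 pp) // IH.
have P0 := dvdn_gt0 k0 P.
by rewrite ler_ln ?posrE ?ltr0n // ler_nat dvdn_leq.
Qed.

(** A Mertens-type bound, from double counting the pairs [p %| k] with [p <= m]
    and [k <= 16 m]: each [p] is met at least [15 m / p] times, and the total is
    at most the sum of the [ln k].  Taking a multiple of [m] as the range of
    [k] keeps the loss in rounding [16 m / p] within the factor [16 / 15]. *)
Lemma sum_ln_prime_div_le m : (0 < m)%N ->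
  sum_ln_prime_div m <= 16 / 15 * (ln m%:R + ln 16).
Proof.
move=> m0; pose n := (m * 16)%N.
have m0' : 0 < m%:R :> R by rewrite ltr0n.
have n0 : (0 < n)%N by rewrite muln_gt0 m0.
have up : \sum_(1 <= k < n.+1) \sum_(1 <= p < m.+1 | prime p && (p %| k)%N) ln p%:R
     <= n%:R * ln n%:R :> R.
  apply: (@le_trans _ _ (\sum_(1 <= k < n.+1) ln n%:R)); last first.
    by rewrite sumr_const_nat subSS subn0 mulr_natl.
  rewrite big_seq [leRHS]big_seq; apply: ler_sum => k.
  rewrite mem_index_iota => /andP[k0 kn].
  apply: (le_trans (sum_ln_primes_dvd_le m k0)).
  by rewrite ler_ln ?posrE ?ltr0n // ler_nat.
have ex : \sum_(1 <= k < n.+1) \sum_(1 <= p < m.+1 | prime p && (p %| k)%N) ln p%:R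
   = \sum_(1 <= p < m.+1 | prime p) ln p%:R * (n %/ p)%:R :> R.
  under eq_bigr do rewrite big_mkcondr.
  rewrite exchange_big /=; apply: eq_bigr => p _.
  rewrite -big_mkcond /= big_const_seq iter_addr_0 -[_ *+ _]mulr_natr.
  by rewrite count_dvdn_iota.
have low : 15 * m%:R * sum_ln_prime_div m <=
   \sum_(1 <= p < m.+1 | prime p) ln p%:R * (n %/ p)%:R.
  rewrite /sum_ln_prime_div mulr_sumr big_seq_cond [leRHS]big_seq_cond.
  apply: ler_sum => p; rewrite mem_index_iota => /andP[/andP[p0 pm] pp].
  have p0' : 0 < p%:R :> R by rewrite ltr0n.
  rewrite mulrCA ler_wpM2l ?ln_ge0 ?ler1n // ler_pdivrMr // -!natrM ler_nat.
  have := divn_eq n p; have := ltn_pmod n p0; rewrite /n; lia.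
rewrite ex in up; have := le_trans low up.
rewrite /n !natrM lnM ?posrE ?ltr0n // => h.
rewrite -(ler_pM2l (_ : 0 < 15 * m%:R)) ?mulr_gt0 //.
apply: (le_trans h); rewrite le_eqVlt; apply/orP; left; apply/eqP.
by field.
Qed.

Lemma ln_nat_unbounded (M : R) : exists N0, forall n, (N0 <= n)%N -> M <= ln n%:R.
Proof.
exists (Num.bound (expR M)) => n nN.
have h : expR M <= n%:R.
  apply: (le_trans (ltW (archi_boundP (expR_ge0 M)))); by rewrite ler_nat.
by rewrite -[leLHS]expRK ler_ln ?posrE ?expR_gt0 // (lt_le_trans (expR_gt0 M)).
Qed.

Lemma sum_ln_prime_div_gt0 N : (2 <= N)%N -> 0 < sum_ln_prime_div N.
Proof.
elim: N => // N IH; rewrite leq_eqVlt => /orP[/eqP<-|N2]; rewrite sum_ln_prime_divS.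
  rewrite ltr_wpDl //.
    by apply: sumr_ge0 => p /prime_gt0 p0; rewrite divr_ge0 // ln_ge0 // ler1n.
  by rewrite /= divr_gt0 // ln_gt0 // ltr1n.
rewrite ltr_wpDr ?IH //; case: ifP => // _.
by rewrite divr_ge0 // ln_ge0 // ler1n.
Qed.

End PrimeSums.

(** * Growth of the mean *)

Section Growth.
Variable R : realType.
Implicit Types (N n m : nat).

(** With [L = ln q] and [s] the sum of [ln p / p] over the primes below [q],
    this carries [T <= C * sqrt s] through the prime [q].  The increment of
    [C * sqrt s] is [C * L / q] divided by [sqrt s + sqrt (s + L / q)], hence at
    least [C * L / (2 q * sqrt (1.15 L))]; it has to absorb
    [C * (sqrt 2 - 1) * sqrt s / q + sqrt L / q].  Both sides are of order
    [sqrt L / q], and the constants leave room as [2 * 1.15 * (sqrt 2 - 1) < 1]. *)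
Lemma mean_load_step (L q s T C : R) :
  0 < L -> 0 < q -> 0 <= s -> s + L / q <= 23 / 20 * L -> 100 <= C ->
  T <= C * Num.sqrt s ->
  T * (1 + (Num.sqrt 2 - 1) / q) + Num.sqrt L / q <= C * Num.sqrt (s + L / q).
Proof.
move=> L0 q0 s0 sL C100 TC.
have a0 : 0 <= Num.sqrt 2 - 1 :> R by rewrite subr_ge0 sqrt2_ge1.
have a1 : Num.sqrt 2 - 1 <= 83 / 200 :> R.
  have r0 : 0 <= Num.sqrt 2 :> R by exact: sqrtr_ge0.
  have : Num.sqrt 2 ^+ 2 = 2 :> R by rewrite sqr_sqrtr.
  by nra.
move: a0 a1; set a := Num.sqrt 2 - 1 => a0 a1.
have Lq0 : 0 < L / q by rewrite divr_gt0.
have uE : Num.sqrt s ^+ 2 = s by rewrite sqr_sqrtr.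
have vE : Num.sqrt (s + L / q) ^+ 2 = s + L / q.
  by rewrite sqr_sqrtr // addr_ge0 // ltW.
have wE : Num.sqrt L ^+ 2 = L by rewrite sqr_sqrtr // ltW.
have u0 : 0 <= Num.sqrt s by exact: sqrtr_ge0.
have w0 : 0 < Num.sqrt L by rewrite sqrtr_gt0.
have v0 : 0 < Num.sqrt (s + L / q) by rewrite sqrtr_gt0 ltr_wpDl.
have uv : Num.sqrt s <= Num.sqrt (s + L / q) by rewrite ler_wsqrtr // lerDl ltW.
move: uE vE wE u0 w0 v0 uv TC.
set u := Num.sqrt s; set v := Num.sqrt (s + _); set w := Num.sqrt L.
move=> uE vE wE u0 w0 v0 uv TC.
have q1 : 0 <= q^-1 by rewrite invr_ge0 ltW.
have Tle : T * (1 + a / q) <= C * u * (1 + a / q).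
  by rewrite ler_wpM2r // addr_ge0 // mulr_ge0.
have vw : v <= 11 / 10 * w by nra.
have vv : v ^+ 2 <= 23 / 20 * w ^+ 2 by rewrite vE wE.
have key : (C * u * a + w) * (u + v) <= C * w ^+ 2.
  have h1 : C * u * a + w <= C * v * (83 / 200) + w.
    rewrite lerD2r -!mulrA ler_wpM2l //; first by lra.
    by apply: ler_pM.
  apply: (@le_trans _ _ ((C * v * (83 / 200) + w) * (2 * v))).
    apply: ler_pM => //; last by lra.
    - by rewrite addr_ge0 ?mulr_ge0 //; lra.
    - by lra.
  have h2 : C * v ^+ 2 <= C * (23 / 20 * w ^+ 2) by rewrite ler_wpM2l //; lra.
  have h3 : w * v <= w * (11 / 10 * w) by rewrite ler_wpM2l // ltW.
  have h4 : 100 * w ^+ 2 <= C * w ^+ 2 by rewrite ler_wpM2r // exprn_ge0 // ltW.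
  by nra.
have uv0 : 0 < u + v by lra.
have dif : v - u = w ^+ 2 / q / (u + v).
  have : (v - u) * (u + v) = w ^+ 2 / q by rewrite wE; nra.
  by move=> <-; rewrite mulfK // lt0r_neq0.
have : (C * u * a + w) / q <= C * (v - u).
  have -> : C * (v - u) = C * w ^+ 2 / (u + v) / q.
    by rewrite dif; field; rewrite !lt0r_neq0.
  by rewrite ler_wpM2r // ler_pdivlMr.
have : C * u * (1 + a / q) + w / q = C * u + (C * u * a + w) / q by ring.
by lra.
Qed.

(** Beyond some [N0] the sum of [ln p / p] is at most [1.15 * ln N], so that
    [mean_load_step] applies; [C] is chosen to make the induction start at [N0]. *)
Lemma mean_load_le : exists2 C : R, 0 < C & exists N0, forall N, (N0 <= N)%N ->
  mean_load R N <= C * Num.sqrt (ln N%:R).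
Proof.
have [N1 N1P] := @ln_nat_unbounded R (13 * ln 16).
(* [13] is large enough: [16 / 15 * (1 + 1 / 13) <= 23 / 20]; [N0 >= 2] makes
   the sum over primes positive. *)
pose N0 := (N1 + 2)%N.
have sle N : (N0 <= N)%N -> sum_ln_prime_div R N <= 23 / 20 * ln N%:R.
  move=> NN.
  have N0' : (0 < N)%N by move: NN; rewrite /N0; lia.
  have := N1P N; rewrite (leq_trans _ NN) ?leq_addr // => /(_ isT).
  have : 0 <= ln 16 :> R by rewrite ln_ge0 // ler1n.
  have := sum_ln_prime_div_le R N0'; lra.
have s0 : 0 < sum_ln_prime_div R N0 by rewrite sum_ln_prime_div_gt0 // leq_addl.
pose C := Num.max 100 (mean_load R N0 / Num.sqrt (sum_ln_prime_div R N0)).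
have C100 : 100 <= C by rewrite le_max lexx.
have main N : (N0 <= N)%N -> mean_load R N <= C * Num.sqrt (sum_ln_prime_div R N).
  elim: N => [|N IH]; first by rewrite /N0 addn2.
  rewrite leq_eqVlt => /orP[/eqP<-|NN].
    by rewrite -ler_pdivrMr ?sqrtr_gt0 // le_max lexx orbT.
  have {}IH := IH NN; have := sle N.+1 (leqW NN); rewrite sum_ln_prime_divS /=.
  case: ifP => qp; last by rewrite addr0.
  move=> sL; apply: mean_load_step => //.
  - by rewrite ln_gt0 // ltr1n prime_gt1.
  - by apply: ltW; apply: sum_ln_prime_div_gt0; apply: leq_trans (leq_addl _ _) NN.
exists (C * 2); first by rewrite mulr_gt0 //; lra.
exists N0 => N NN; apply: (le_trans (main N NN)).
rewrite -mulrA ler_wpM2l //; first by lra.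
have l0 : 0 <= ln N%:R :> R.
  by rewrite ln_ge0 // ler1n (leq_trans _ NN) // /N0 addn2.
rewrite -[leRHS]ger0_norm ?mulr_ge0 ?sqrtr_ge0 // -sqrtr_sqr.
rewrite ler_wsqrtr // exprMn sqr_sqrtr //; have := sle N NN; lra.
Qed.

End Growth.

(** * Exceptional integers are rare *)

Lemma count_le_iota j N : (count (fun n => n <= j)%N (iota 1 N) <= j)%N.
Proof.
rewrite -size_filter.
have /uniq_leq_size : {subset [seq n <- iota 1 N | (n <= j)%N] <= iota 1 j}.
  move=> n; rewrite mem_filter !mem_iota => /and3P[nj n1 _].
  by rewrite n1 add1n ltnS.
by rewrite size_iota filter_uniq ?iota_uniq // => /(_ isT).
Qed.

Section Exceptions.
Variable R : realType.
Implicit Types (N n m : nat).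

Lemma count_markov (t : R) (F : nat -> R) (s : seq nat) :
  (forall n, 0 <= F n) ->
  t * (count (fun n => t < F n) s)%:R <= \sum_(n <- s) F n.
Proof.
move=> F0; elim: s => [|n s IH]; first by rewrite big_nil mulr0.
rewrite big_cons /= natrD mulrDr; apply: lerD => //.
by case: ltP => h /=; rewrite ?mulr1 ?mulr0 // ltW.
Qed.

(** The hypothesis [N <= n ^ 2] compares [ln n] with [ln N]. *)
Lemma B_le_powR (k a : R) N n : 0 <= k -> (0 < n <= N)%N -> (N <= n ^ 2)%N ->
  load R N n <= k * Num.sqrt (ln N%:R) -> 2 * k ^+ 2 <= a ->
  (B n)%:R <= (n%:R : R) `^ ((tau n)%:R * a).
Proof.
move=> k0 /andP[n0 nN] Nn2 hload ka.
have n0' : 0 < n%:R :> R by rewrite ltr0n.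
have lnN : 0 <= ln N%:R :> R by rewrite ln_ge0 // ler1n (leq_trans n0).
have lnn : ln N%:R <= 2 * ln n%:R :> R.
  rewrite mulr_natl -lnXn // ler_ln ?posrE ?exprn_gt0 ?ltr0n ?(leq_trans n0) //.
  by rewrite -natrX ler_nat.
apply: (@le_trans _ _ (expR ((tau n)%:R * load R N n ^+ 2))).
  by apply: B_le_expR; rewrite n0.
rewrite /powR (gt_eqF n0') ler_expR -mulrA ler_wpM2l //.
apply: (@le_trans _ _ ((k * Num.sqrt (ln N%:R)) ^+ 2)).
  by rewrite ler_pXn2r ?nnegrE ?load_ge0 ?mulr_ge0 ?sqrtr_ge0.
rewrite exprMn sqr_sqrtr //.
apply: (@le_trans _ _ (k ^+ 2 * (2 * ln n%:R))).
  by rewrite ler_wpM2l // exprn_ge0.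
by rewrite mulrA (mulrC (k ^+ 2)) ler_wpM2r // ln_ge0 // ler1n.
Qed.

End Exceptions.

Theorem theorem1p2 (R : realType) (psi : nat -> R)
    (psi_infty : psi n @[n --> \oo] --> +oo) :
  for_almost_all R (fun n : nat =>
    (B n)%:R <= (n%:R : R) `^ ((tau n)%:R * psi n)).
Proof.
apply/cvgrPdist_le => eps eps0.
have [C C0 [N0 mean]] := mean_load_le R.
(* By Markov's inequality, the load exceeds [k * sqrt (ln N)] for a proportion
   at most [C / k = eps / 3] of the integers up to [N]. *)
pose k := 3 * C / eps.
have k0 : 0 < k by rewrite divr_gt0 // mulr_gt0.
have [n1 _ psiP] := (cvgryPge _).1 psi_infty (2 * k ^+ 2).
(* The integers [n <= N / l] are a proportion at most [eps / 3]; the others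
   satisfy [N <= n ^ 2] as soon as [l ^ 2 <= N]. *)
pose l := (Num.bound (3 / eps)).+1.
have lP : 1 / l%:R <= eps / 3.
  have := archi_boundP (ltW (divr_gt0 (ltr0n R 3) eps0)) => h.
  have h' : 3 / eps < l%:R by rewrite (lt_trans h) // ltr_nat.
  rewrite ler_pdivrMr ?ltr0n //; move: h'; rewrite ltr_pdivrMr //; lra.
near=> N.
have N_gt1 : (1 < N)%N by near: N; exact: nbhs_infty_gt.
have NN0 : (N0 <= N)%N by near: N; exact: nbhs_infty_ge.
have Nl : (l ^ 2 <= N)%N by near: N; exact: nbhs_infty_ge.
have Nn1 : 3 * n1%:R / eps <= N%:R by near: N; exact: nbhs_infty_ger.
have Npos : 0 < N%:R :> R by rewrite ltr0n (ltn_trans _ N_gt1).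
have sqN : 0 < Num.sqrt (ln N%:R) :> R by rewrite sqrtr_gt0 ln_gt0 // ltr1n.
rewrite sub0r normrN ger0_norm ?divr_ge0 // ler_pdivrMr //.
pose t := k * Num.sqrt (ln N%:R).
have t0 : 0 < t by rewrite mulr_gt0.
set bad := fun n => n \in _.
(* A bad integer is either small or has a large load. *)
have cnt : (count bad (iota 1 N) <= count (fun n => n <= n1 + N %/ l)%N (iota 1 N)
   + count (fun n => (t < load R N n)%R) (iota 1 N))%N.
  rewrite -count_predUI (leq_trans _ (leq_addr _ _)) //.
  rewrite -!size_filter.
  apply: uniq_leq_size; first by rewrite filter_uniq // iota_uniq.
  move=> n; rewrite !mem_filter => /andP[nbad nN]; rewrite nN andbT /=.
  move: nN nbad; rewrite mem_iota add1n ltnS => /andP[n0 nN].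
  rewrite /bad inE /= => -[_ nB].
  rewrite leqNgt -implybE; apply/implyP => nj; rewrite ltNge; apply/negP => ht.
  apply: nB; apply: (@B_le_powR R k _ N n (ltW k0)); rewrite ?n0 //.
    have nl : (N < n * l)%N.
      by rewrite -ltn_divLR // (leq_ltn_trans (leq_addl _ _) nj).
    have : (N * l ^ 2 <= n ^ 2 * l ^ 2)%N.
      rewrite -expnMn (leq_trans (leq_mul (leqnn N) Nl)) //.
      by rewrite mulnn leq_exp2r // ltnW.
    by rewrite leq_pmul2r // expn_gt0.
  by apply: psiP; apply: leq_trans (leq_addr _ _) (ltnW nj).
have cnt2 : t * (count (fun n => (t < load R N n)%R) (iota 1 N))%:R
    <= N%:R * (C * Num.sqrt (ln N%:R)).
  apply: (le_trans (count_markov _ _ (load_ge0 R N))).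
  apply: (@le_trans _ _ (N%:R / 1%:R * mean_load R N)).
    have -> : \sum_(n <- iota 1 N) load R N n =
              \sum_(1 <= n < N.+1 | (1 %| n)%N) load R N n.
      by rewrite /index_iota subn1; apply: eq_bigl => n; rewrite dvd1n.
    apply: sum_load_le => // p pp _; rewrite dvdn1.
    by apply/eqP => p1; rewrite p1 in pp.
  by rewrite divr1 ler_wpM2l // mean.
have {}cnt2 : (count (fun n => (t < load R N n)%R) (iota 1 N))%:R
    <= eps / 3 * N%:R.
  rewrite -(ler_pM2l t0) (le_trans cnt2) // le_eqVlt; apply/orP; left; apply/eqP.
  by rewrite /t /k; field; rewrite lt0r_neq0.
have cnt1 : (count (fun n => n <= n1 + N %/ l)%N (iota 1 N))%:R
    <= eps / 3 * N%:R + eps / 3 * N%:R.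
  apply: (@le_trans _ _ (n1 + N %/ l)%:R); first by rewrite ler_nat count_le_iota.
  rewrite natrD lerD //.
    by move: Nn1; rewrite ler_pdivrMr //; lra.
  apply: (@le_trans _ _ (1 / l%:R * N%:R)); last by rewrite ler_wpM2r.
  by rewrite mulrAC mul1r ler_pdivlMr ?ltr0n // -natrM ler_nat leq_trunc_div.
apply: (@le_trans _ _ ((count (fun n => n <= n1 + N %/ l)%N (iota 1 N)) +
  (count (fun n => (t < load R N n)%R) (iota 1 N)))%:R); first by rewrite ler_nat.
rewrite natrD; lra.
Unshelve. all: end_near.
Qed.
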